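(* Let $\alpha,\beta,\gamma,\delta,\epsilon$ be real numbers such that $\alpha,\beta,\gamma$ are successive terms of an arithmetic progression, $\beta,\gamma,\delta$ are consecutive terms of a geometric progression, and $\gamma,\delta,\epsilon$ are successive terms of a harmonic progression. Then either the numbers $\alpha,\gamma,\epsilon$ or the numbers $\epsilon,\gamma,\alpha$ (in the given order) are consecutive terms of a geometric progression.
   Context: A real sequence is an arithmetic progression if there is a fixed real $d$ with $a_{n+1}=a_n+d$ for all $n$; it is a geometric progression if there is a fixed real $r$ with $a_{n+1}=r a_n$ for all $n$; it is a harmonic progression if all its terms are nonzero and the sequence of reciprocals $\frac1{a_n}$ is an arithmetic progression. *)

(* Defs.v *)
From Stdlib Require Import Reals.

Open Scope R_scope.

(* Real sequences may be finite or infinite: a sequence is a function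
   [a : nat -> R] together with a length [N], where [None] stands for an
   infinite sequence; values of [a] at indices outside the range are ignored.
   Finite sequences are needed because, for instance, 1/3, 1/2, 1 is a harmonic
   progression which cannot be continued. *)
Definition in_range (N : option nat) (n : nat) : Prop :=
  match N with
  | Some m => (n < m)%nat
  | None => True
  end.

Definition arithmetic_progression (N : option nat) (a : nat -> R) : Prop :=
  exists d : R, forall n : nat, in_range N (S n) -> a (S n) = a n + d.

(* The ratio, and hence terms, may be zero. *)
Definition geometric_progression (N : option nat) (a : nat -> R) : Prop :=
  exists r : R, forall n : nat, in_range N (S n) -> a (S n) = r * a n.

Definition harmonic_progression (N : option nat) (a : nat -> R) : Prop :=
  (forall n : nat, in_range N n -> a n <> 0) /\
  arithmetic_progression N (fun n => 1 / a n).

Definition consecutive_terms (N : option nat) (a : nat -> R) (x y z : R) : Prop :=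
  exists n : nat,
    in_range N (S (S n)) /\ a n = x /\ a (S n) = y /\ a (S (S n)) = z.

Definition consecutive_terms_of (P : option nat -> (nat -> R) -> Prop)
    (x y z : R) : Prop :=
  exists (N : option nat) (a : nat -> R), P N a /\ consecutive_terms N a x y z.

(* Main.v *)
Require Import Defs.
From Stdlib Require Import Reals Lra Lia.

Open Scope R_scope.

(** Three consecutive terms satisfy the mean relations
    [2 * beta = alpha + gamma], [gamma * gamma = beta * delta] and
    [delta * (gamma + epsilon) = 2 * (gamma * epsilon)].  Eliminating [beta]
    from the first two gives [(alpha + gamma) * delta = 2 * (gamma * gamma)];
    multiplying this by [epsilon] and using the third relation, then cancelling
    the nonzero [delta], leaves [gamma * gamma = alpha * epsilon].  As [gamma]
    is a term of a harmonic progression it is nonzero, hence so is [alpha], and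
    [alpha, gamma, epsilon] is geometric with ratio [gamma / alpha].  Thus it is
    always the first alternative of the conclusion that holds. *)

Lemma in_range_pred (N : option nat) (n : nat) :
  in_range N (S n) -> in_range N n.
Proof. destruct N as [m|]; simpl; [lia | trivial]. Qed.

Lemma arithmetic_mean (x y z : R) :
  consecutive_terms_of arithmetic_progression x y z -> 2 * y = x + z.
Proof.
  intros (N & a & [d Hd] & n & Hn & <- & <- & <-).
  rewrite (Hd (S n) Hn), (Hd n (in_range_pred _ _ Hn)). lra.
Qed.

Lemma geometric_mean (x y z : R) :
  consecutive_terms_of geometric_progression x y z -> y * y = x * z.
Proof.
  intros (N & a & [r Hr] & n & Hn & <- & <- & <-).
  rewrite (Hr (S n) Hn), (Hr n (in_range_pred _ _ Hn)). ring.
Qed.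

(** The mean relation characterizes geometric triples only when the first term
    is nonzero: [0, 0, 1] satisfies it, but every term after a zero is zero. *)
Lemma geometric_of_mean (x y z : R) :
  x <> 0 -> y * y = x * z ->
  consecutive_terms_of geometric_progression x y z.
Proof.
  intros Hx Hxyz.
  exists None, (fun n => (y / x) ^ n * x). split.
  - exists (y / x). intros n _. simpl. ring.
  - exists 0%nat. repeat split; simpl.
    + ring.
    + now field.
    + replace (y / x * (y / x * 1) * x) with (y * y / x) by now field.
      rewrite Hxyz. now field.
Qed.

Lemma harmonic_mean (x y z : R) :
  consecutive_terms_of harmonic_progression x y z ->
  x <> 0 /\ y <> 0 /\ y * (x + z) = 2 * (x * z).
Proof.
  intros (N & a & [Hnz Ha] & n & Hn & <- & <- & <-).
  assert (H0 : a n <> 0) by (apply Hnz; do 2 apply in_range_pred; exact Hn).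
  assert (H1 : a (S n) <> 0) by (apply Hnz, in_range_pred, Hn).
  assert (H2 : a (S (S n)) <> 0) by (apply Hnz, Hn).
  assert (Hmean : 2 * (1 / a (S n)) = 1 / a n + 1 / a (S (S n))).
  { apply arithmetic_mean.
    exists N, (fun k => 1 / a k). split; [exact Ha |].
    now exists n. }
  split; [exact H0 | split; [exact H1 |]].
  replace (a (S n) * (a n + a (S (S n))))
    with (a n * a (S n) * a (S (S n)) * (1 / a n + 1 / a (S (S n))))
    by now field.
  rewrite <- Hmean. now field.
Qed.

Theorem mainTheorem6 (alpha beta gamma delta epsilon : R)
  (h_arith : consecutive_terms_of arithmetic_progression alpha beta gamma)
  (h_geom : consecutive_terms_of geometric_progression beta gamma delta)
  (h_harm : consecutive_terms_of harmonic_progression gamma delta epsilon) :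
  consecutive_terms_of geometric_progression alpha gamma epsilon \/
  consecutive_terms_of geometric_progression epsilon gamma alpha.
Proof.
  apply arithmetic_mean in h_arith.
  apply geometric_mean in h_geom.
  apply harmonic_mean in h_harm as (Hgamma & Hdelta & h_harm).
  assert (Hmean : gamma * gamma = alpha * epsilon).
  { apply (Rmult_eq_reg_l delta); [| exact Hdelta].
    assert (Helim : (alpha + gamma) * delta = 2 * (gamma * gamma))
      by (rewrite <- h_arith, h_geom; ring).
    apply (f_equal (Rmult epsilon)) in Helim.
    apply (f_equal (Rmult gamma)) in h_harm.
    lra. }
  left. apply geometric_of_mean; [| exact Hmean].
  intros Halpha. rewrite Halpha, Rmult_0_l in Hmean.
  now apply Rmult_integral in Hmean as [H | H].
Qed.
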